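(* Let $X$ be a complete topologized semilattice, let $Y$ be a semitopological semilattice satisfying the separation axiom $\vec{T}_{2\delta}$, and let $h:X\to Y$ be a continuous homomorphism. Then the image $h(X)$ is closed in $Y$.
   Context: A semilattice is a commutative semigroup all of whose elements are idempotents ($xx=x$). It carries the natural partial order $x\le y$ iff $xy=x$ $(=yx)$. A homomorphism of semilattices is a map $h$ with $h(xy)=h(x)h(y)$ for all $x,y$. A subset $C$ of a semilattice is a chain if $xy\in\{x,y\}$ for all $x,y\in C$. A topologized semilattice is a semilattice endowed with a topology (no compatibility and no separation axiom assumed). A semitopological semilattice is a topologized semilattice $X$ whose operation $X\times X\to X$, $(x,y)\mapsto xy$, is separately continuous, i.e. for every $a\in X$ the shift $x\mapsto ax$ is continuous. A topologized semilattice $X$ is complete if each non-empty chain $C\subset X$ has an infimum $\inf C$ and a supremum $\sup C$ in the partially ordered set $(X,\le)$, and $\inf C\in\bar C$ and $\sup C\in\bar C$, where $\bar C$ is the closure of $C$ in $X$. A topological space $Z$ satisfies the separation axiom $T_1$ if for any distinct points $x,y\in Z$ there is an open set $U\subset Z$ with $x\in U$ and $y\notin U$. A topological space $Z$ satisfies the separation axiom $T_{2\delta}$ if $Z$ is a $T_1$-space and for any open set $U\subset Z$ and any point $x\in U$ there exists a countable family $\mathcal U$ of closed neighborhoods of $x$ in $Z$ such that $\bigcap\mathcal U\subset U$. A topological space $Z$ satisfies the separation axiom $\vec{T}_{2\delta}$ if $Z$ admits a bijective continuous map $Z\to W$ onto some topological space $W$ satisfying $T_{2\delta}$. *)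

(* Defs.v *)
From HB Require Import structures.
From mathcomp Require Import all_boot all_order.
From mathcomp Require Import all_classical topology.
Set Implicit Arguments.
Unset Strict Implicit.
Unset Printing Implicit Defensive.
Local Open Scope classical_set_scope.

HB.mixin Record Semigroup_isSemilattice X & Semigroup X := {
  slmulC : commutative (fun x y : X => (x * y)%g) ;
  slmulxx : idempotent_op (fun x y : X => (x * y)%g)
}.

#[short(type="semilatticeType")]
HB.structure Definition Semilattice := {X of Semigroup_isSemilattice X & Semigroup X}.

(* [natural X] is a copy of [X] carrying the order [x <= y] iff [x * y = x];
   the alias avoids imposing an order on types that already have another one. *)
Definition natural (X : Type) : Type := X.

Fact natural_display : Order.disp_t.
Proof. exact: Order.Disp tt tt. Qed.

Section NaturalOrder.
Variable X : semilatticeType.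

Definition natural_le (x y : natural X) : bool := (x * y : X)%g == x.

Lemma natural_le_refl : reflexive natural_le.
Proof. by move=> x; rewrite /natural_le slmulxx. Qed.

Lemma natural_le_anti : antisymmetric natural_le.
Proof. by move=> x y /andP[/eqP xy /eqP yx]; rewrite -xy slmulC yx. Qed.

Lemma natural_le_trans : transitive natural_le.
Proof.
move=> y x z /eqP xy /eqP yz; apply/eqP.
by rewrite -[in LHS]xy -mulgA yz.
Qed.

HB.instance Definition _ := Choice.copy (natural X) X.
HB.instance Definition _ := Order.Le_isPOrder.Build natural_display (natural X)
  natural_le_refl natural_le_anti natural_le_trans.

Definition chain (C : set X) : Prop :=
  forall x y, C x -> C y -> (x * y)%g = x \/ (x * y)%g = y.

End NaturalOrder.

#[short(type="topologizedSemilatticeType")]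
HB.structure Definition TopologizedSemilattice :=
  {X of Semilattice X & Topological X}.

HB.mixin Record TopologizedSemilattice_isSemitopological X
    & TopologizedSemilattice X := {
  shift_continuous : forall a : X, continuous (fun x : X => (a * x)%g)
}.

#[short(type="semitopologicalSemilatticeType")]
HB.structure Definition SemitopologicalSemilattice :=
  {X of TopologizedSemilattice_isSemitopological X & TopologizedSemilattice X}.

Definition complete_semilattice (X : topologizedSemilatticeType) : Prop :=
  forall C : set X, C !=set0 -> chain C ->
    (exists2 i : X, infimums (C : set (natural X)) i & closure C i) /\
    (exists2 s : X, supremums (C : set (natural X)) s & closure C s).

Definition T2delta (Z : topologicalType) : Prop :=
  accessible_space Z /\
  forall (U : set Z) (x : Z), open U -> U x ->
    exists F : set (set Z),
      [/\ countable F,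
          forall V, F V -> closed V /\ nbhs x V &
          \bigcap_(V in F) V `<=` U].

Definition vecT2delta (Z : topologicalType) : Prop :=
  exists (W : topologicalType) (f : Z -> W),
    [/\ bijective f, continuous f & T2delta W].

(* Main.v *)
Require Import Defs.
From HB Require Import structures.
From mathcomp Require Import all_boot all_order.
From mathcomp Require Import finmap.
From mathcomp Require Import all_classical topology.
Local Open Scope classical_set_scope.
Import Order.POrderTheory.
Set Implicit Arguments.
Unset Strict Implicit.
Unset Printing Implicit Defensive.

(** Let y be a limit point of h(X). The idea is to approximate y from below,
    inside X, by a directed set whose supremum is mapped to y.

    The separation axiom enters through the sets G that are the intersection
    of a sequence of closed sets V_n and are contained in the interior of each
    V_n ([regular_Gdelta]). They are stable under preimages by continuous maps
    and under binary intersections, and those containing y intersect in {y}.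
    Thus they behave like clopen neighbourhoods for a finer topology whose
    shifts are still continuous, while being closed for the given one, so that
    completeness of X applies to their preimages.

    - y is still a limit of h(X) for this finer topology
      ([regular_Gdelta_meets_image]): choose points x_0, x_1, ... one after the
      other, so close to y that every product x_n ... x_m is mapped into V_n;
      then sup_n inf_m x_n ... x_m is mapped into all the V_n.

    - Let m be minimal among the x with h(x) y in G. If h(z) is close enough
      to y then h(m z) y is in G, hence m z = m by minimality, that is m <= z.
      Passing to the limit, h(m) <= y, so h(m) = h(m) y is in G. Hence every G
      contains the image of some point lying below all z with h(z) close to y
      ([below_near_in]).

    - The points of X lying below all z with h(z) close to y form a directed
      set, in which those mapped into a given G are cofinal. In a complete
      semilattice a directed set D has a supremum in the closure of each of its
      cofinal subsets ([directed_supremum_in]). Hence this supremum is mapped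
      into every G, that is, to y.

    The passage from chains to directed sets ([directed_supremum]) is an
    Iwamura type argument, done with Zorn's lemma instead of an induction on
    cardinals. *)

Local Notation "x ≼ y" := (Order.le (x : natural _) (y : natural _))
  (at level 70, no associativity).

(** * The natural order of a semilattice *)

Section SemilatticeOrder.
Variable X : semilatticeType.
Implicit Types x y z : X.

Lemma natural_leP x y : reflect ((x * y)%g = x) (x ≼ y).
Proof. exact: eqP. Qed.

Lemma mul_lel x y : (x * y)%g ≼ x.
Proof. by apply/natural_leP; rewrite (slmulC (x * y)%g x) mulgA slmulxx. Qed.

Lemma mul_ler x y : (x * y)%g ≼ y.
Proof. by rewrite slmulC; exact: mul_lel. Qed.

Lemma chainP (C : set X) :
  chain C <-> (forall x y, C x -> C y -> x ≼ y \/ y ≼ x).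
Proof.
split=> CC x y Cx Cy.
  have [xy|yx] := CC x y Cx Cy; first by left; apply/natural_leP.
  by right; apply/natural_leP; rewrite slmulC.
by have [/natural_leP xy|/natural_leP yx] := CC x y Cx Cy;
  [left|right; rewrite slmulC].
Qed.

Definition directed (D : set X) : Prop :=
  forall x y, D x -> D y -> exists z, [/\ D z, x ≼ z & y ≼ z].

Lemma supremum_le (A B : set X) (s t : X) :
  supremums (A : set (natural X)) s -> supremums (B : set (natural X)) t ->
  (forall a, A a -> exists2 b, B b & a ≼ b) -> s ≼ t.
Proof.
move=> [_ lubs] [ubt _] AB; apply: lubs => a /AB[b Bb ab].
exact: le_trans ab (ubt _ Bb).
Qed.

Lemma directed_upper_bound (D : set X) : D !=set0 -> directed D ->
  exists b : seq X -> X, forall l : seq X, (forall x, x \in l -> D x) ->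
    D (b l) /\ forall x, x \in l -> x ≼ b l.
Proof.
move=> [d Dd] Ddir.
suff /boolp.choice[b bP] : forall l : seq X, exists u : X,
    (forall x, x \in l -> D x) -> D u /\ forall x, x \in l -> x ≼ u.
  by exists b.
elim=> [|a l [u IH]]; first by exists d.
have [lD|nD] := pselect (forall x, x \in a :: l -> D x); last by exists d.
have [|Du lu] := IH; first by move=> x xl; apply: lD; rewrite inE xl orbT.
have [|z [Dz az uz]] := Ddir a u _ Du; first by apply: lD; rewrite mem_head.
exists z => _; split=> // x; rewrite inE => /orP[/eqP ->//|/lu xu].
exact: le_trans xu uz.
Qed.

(** The sets of values [u F], for [F] ranging over the finite subsets of a set
    [E], are directed, are increasing and compatible with directed unions in
    [E], and have a greatest element when [E] is finite. This reduces directed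
    sets to unions of chains of smaller ones. *)
Lemma directed_monotone_bound (D : set X) : D !=set0 -> directed D ->
  exists u : {fset X} -> X,
    [/\ forall F : {fset X}, (forall x, x \in F -> D x) -> D (u F),
        forall (F : {fset X}) x, (forall x, x \in F -> D x) -> x \in F ->
          x ≼ u F &
        forall F G : {fset X}, (forall x, x \in G -> D x) -> (F `<=` G)%fset ->
          u F ≼ u G].
Proof.
move=> D0 /(directed_upper_bound D0)[b bP].
(* [v n F] bounds [F] and all the [v m G] with [m < n] and [G] included in [F];
   [n = #|F|] steps are enough to dominate all proper subsets of [F]. *)
pose v := fix v n (F : {fset X}) : X :=
  if n is m.+1 then b ([seq v m G | G <- fpowerset F] ++ enum_fset F)
  else b (enum_fset F).
have vD n (F : {fset X}) : (forall x, x \in F -> D x) -> D (v n F).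
  elim: n F => [|n IH] F FD /=; first by case: (bP F).
  apply: (proj1 (bP _ _)) => x; rewrite mem_cat => /orP[|/FD//].
  case/mapP => G; rewrite fpowersetE => /fsubsetP GF ->.
  by apply: IH => y /GF/FD.
have vS n (F : {fset X}) x : (forall x, x \in F -> D x) ->
    x \in [seq v n G | G <- fpowerset F] ++ enum_fset F -> D x.
  move=> FD; rewrite mem_cat => /orP[|/FD//].
  case/mapP => G; rewrite fpowersetE => /fsubsetP GF ->.
  by apply: vD => y /GF/FD.
have vsub n (F G : {fset X}) : (forall x, x \in G -> D x) -> (F `<=` G)%fset ->
    v n F ≼ v n.+1 G.
  move=> GD FG; apply: (proj2 (bP _ (@vS n G ^~ GD))).
  by rewrite mem_cat map_f // fpowersetE.
have vle m n (F : {fset X}) : (forall x, x \in F -> D x) -> (m <= n)%N ->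
    v m F ≼ v n F.
  move=> FD; elim: n => [|n IH]; first by rewrite leqn0 => /eqP ->.
  rewrite leq_eqVlt => /orP[/eqP -> //|/IH mn].
  by apply: (le_trans mn); apply: vsub.
exists (fun F => v #|` F| F); split=> [F FD|F x FD xF|F G GD FG].
- exact: vD.
- case: #|` F| => [|n] /=; first by case: (bP F) => // _; apply.
  by apply: (proj2 (bP _ (@vS n F ^~ FD))); rewrite mem_cat xF orbT.
- have [->//|FnG] := eqVneq F G.
  have : (#|` F| < #|` G|)%N by apply: fproper_ltn_card; rewrite fproperEneq FnG.
  case: #|` G| => // n; rewrite ltnS => Fn.
  apply: (@le_trans _ (natural X) (v n F)); last exact: vsub.
  by apply: vle => // x /(fsubsetP FG)/GD.
Qed.

End SemilatticeOrder.

(** * Directed sets in complete topologized semilattices *)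

Section CompleteSemilattice.
Variable X : topologizedSemilatticeType.
Hypothesis cX : complete_semilattice X.

Lemma closed_minimal (M : set X) : closed M -> M !=set0 ->
  exists2 m, M m & forall x, M x -> x ≼ m -> x = m.
Proof.
move=> clM [m0 Mm0].
have [|||A Atot|[m Mm] mmin] := @Zorn {x : X | M x}
    (fun a b => (sval b) ≼ (sval a)).
- by move=> t; apply: lexx.
- by move=> r s t sr ts; apply: le_trans ts sr.
- move=> [s Ms] [t Mt] /= ts st; apply: eq_exist.
  by apply: (@le_anti _ (natural X)); rewrite st ts.
- have [[a Aa]|A0] := pselect (exists a, A a); last first.
    by exists (exist _ m0 Mm0) => s As; case: A0; exists s.
  pose C := [set sval a | a in A].
  have C0 : C !=set0 by exists (sval a), a.
  have Cch : chain C.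
    apply/chainP => _ _ [s As <-] [t At <-].
    by have [|] := Atot _ _ As At; [right|left].
  have [[i [lbi _] cli] _] := cX C0 Cch.
  have Mi : M i.
    by apply: clM; apply: closureS cli => _ [s _ <-]; exact: (proj2_sig s).
  by exists (exist _ i Mi) => s As /=; apply: lbi; exists s.
- exists m => // x Mx xm.
  by have := mmin (exist _ x Mx) xm => /(congr1 sval).
Qed.

(** Zorn's lemma is applied to the subsets [E] of [D] such that the claim holds
    for [E] enlarged by an arbitrary finite subset [F] of [D], the enlarged
    set being made directed by a monotone bound [u]. Quantifying over [F] makes
    a maximal [E] absorb every point of [D], and unions of chains are handled
    by the supremum of the chain of the suprema. *)
Theorem directed_supremum (D : set X) : D !=set0 -> directed D ->
  exists2 s : X, supremums (D : set (natural X)) s & closure D s.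
Proof.
move=> D0 Ddir.
have [u [uD u_ub u_mono]] := directed_monotone_bound D0 Ddir.
pose U (E : set X) : set X :=
  [set u F | F in [set F : {fset X} | forall x, x \in F -> E x]].
have US E E' : E `<=` E' -> U E `<=` U E'.
  by move=> EE' _ [F FE <-]; exists F => // x /FE/EE'.
pose P : set (set X) := [set E | E `<=` D /\
  forall F : {fset X}, (forall x, x \in F -> D x) ->
  exists2 s : X, supremums (U (E `|` [set` F]) : set (natural X)) s
               & closure D s].
have [Fam FP Ftot|E [[ED EP] Emax]] := @Zorn_bigcup X P.
  split=> [x [E /FP[ED _] /ED]//|F FD].
  (* The empty chain: [U F] has the greatest element [u F]. *)
  have [[E0 FE0]|Fam0] := pselect (exists E, Fam E); last first.
    exists (u F); last by apply: subset_closure; exact: uD.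
    split=> [_ [G GF <-]|t tub].
      apply: u_mono => //; apply/fsubsetP => x /GF[[E FE]|//].
      by case: Fam0; exists E.
    by apply: tub; exists F => // x xF; right.
  pose C : set X := [set s | exists2 E, Fam E &
    supremums (U (E `|` [set` F]) : set (natural X)) s].
  have Ccl : C `<=` closure D.
    move=> s [E FE sE]; have [_ /(_ F FD)[t tE Dt]] := FP _ FE.
    suff -> : s = t by [].
    by apply: (@le_anti _ (natural X));
      rewrite !(supremum_le sE tE, supremum_le tE sE) // => a Ca; exists a.
  have C0 : C !=set0.
    by have [_ /(_ F FD)[t tE Dt]] := FP _ FE0; exists t, E0.
  have Cch : chain C.
    have Cle s t E E' : supremums (U (E `|` [set` F]) : set (natural X)) s ->
        supremums (U (E' `|` [set` F]) : set (natural X)) t -> E `<=` E' ->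
        s ≼ t.
      move=> sE tE EE'; apply: (supremum_le sE tE) => a aU; exists a => //.
      by move: a aU; apply: US; exact: setSU.
    apply/chainP => s t [E FE sE] [E' FE' tE'].
    by have [EE'|EE'] := Ftot _ _ FE FE'; [left|right]; exact: Cle EE'.
  have [_ [s [ubs lubs] cls]] := cX C0 Cch.
  exists s; last by apply: (@closed_closure X D); exact: closureS cls.
  have fin (l : seq X) :
      (forall x, x \in l -> (\bigcup_(X in Fam) X `|` [set` F]) x) ->
      exists2 E, Fam E & forall x, x \in l -> (E `|` [set` F]) x.
    elim: l => [_|a l IH lF]; first by exists E0.
    have [|E FE lE] := IH; first by move=> x xl; apply: lF; rewrite inE xl orbT.
    have [[E' FE' E'a]|Fa] := lF _ (mem_head a l); last first.
      by exists E => // x; rewrite inE => /orP[/eqP ->|/lE//]; right.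
    have [EE'|EE'] := Ftot _ _ FE FE'.
      exists E' => // x; rewrite inE => /orP[/eqP ->|/lE[/EE'|]]; first by left.
        by left.
      by right.
    exists E => // x; rewrite inE => /orP[/eqP ->|/lE//]; left; exact: EE'.
  split=> [_ [G /fin[E FE GE] <-]|t tub].
    have [_ /(_ F FD)[r rE _]] := FP _ FE.
    apply: (@le_trans _ (natural X) r); last by apply: ubs; exists E.
    by case: rE => ub _; apply: ub; exists G.
  apply: lubs => r [E FE [_ lubr]]; apply: lubr => a aU; apply: tub.
  by move: a aU; apply: US; apply: setSU => x Ex; exists E.
have DE : D `<=` E.
  move=> d Dd; apply: contrapT => nEd.
  apply: (Emax (E `|` [set d])).
    by split=> [x Ex|/(_ d)]; [left|move=> /(_ (or_intror erefl))].
  split=> [x [/ED//|->//]|F FD].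
  have [|s sE cls] := EP (d |` F)%fset.
    by move=> x; rewrite !inE => /orP[/eqP ->|/FD].
  exists s => //.
  suff <- : E `|` [set` (d |` F)%fset] = E `|` [set d] `|` [set` F] by [].
  by rewrite -setUA set_fsetU set_fset1.
have [//|s [ubs lubs] cls] := EP fset0.
exists s => //; split=> [d Dd|t tub].
  apply: (@le_trans _ (natural X) (u [fset d]%fset)).
    by apply: u_ub => [x|]; rewrite inE // => /eqP ->.
  apply: ubs; exists [fset d]%fset => // x; rewrite inE => /eqP ->.
  by left; exact: DE.
apply: lubs => _ [F FE <-]; apply: tub; apply: uD => x /FE[/ED//|].
by rewrite /= inE.
Qed.

(** A cofinal subset of a directed set is directed and has the same supremum,
    hence the supremum is in its closure. *)
Lemma directed_supremum_in (D A : set X) (s : X) :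
  D !=set0 -> directed D -> supremums (D : set (natural X)) s -> closed A ->
  (forall d, D d -> exists c, [/\ D c, A c & d ≼ c]) -> A s.
Proof.
move=> [d Dd] Ddir sD clA cof.
have DA0 : D `&` A !=set0 by have [c [Dc Ac _]] := cof _ Dd; exists c.
have [x y [Dx _] [Dy _]|t tDA clt] := @directed_supremum (D `&` A) DA0.
  have [z [Dz xz yz]] := Ddir _ _ Dx Dy; have [c [Dc Ac zc]] := cof _ Dz.
  by exists c; split=> //; [exact: le_trans xz zc|exact: le_trans yz zc].
suff -> : s = t by apply: clA; apply: closureS clt => c [].
apply: (@le_anti _ (natural X)); apply/andP; split.
  by apply: (supremum_le sD tDA) => x /cof[c [Dc Ac xc]]; exists c.
by apply: (supremum_le tDA sD) => x [Dx _]; exists x.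
Qed.

End CompleteSemilattice.

(** * Regular G-delta sets *)

(** Such a set is both closed and a countable intersection of open sets. The
    two descriptions use the same sequence, so that for each of its points it
    is an intersection of countably many closed neighbourhoods. *)
Definition regular_Gdelta (Z : topologicalType) (G : set Z) : Prop :=
  exists V : nat -> set Z, [/\ forall n, closed (V n),
    forall n, G `<=` interior (V n) & \bigcap_n V n `<=` G].

Lemma regular_Gdelta_closed (Z : topologicalType) (G : set Z) :
  regular_Gdelta G -> closed G.
Proof.
move=> [V [clV GV VG]].
have -> : G = \bigcap_n V n.
  by apply/seteqP; split=> // z Gz n _; exact: interior_subset (GV n z Gz).
by apply: closed_bigI => n _.
Qed.

Lemma regular_GdeltaI (Z : topologicalType) (G H : set Z) :
  regular_Gdelta G -> regular_Gdelta H -> regular_Gdelta (G `&` H).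
Proof.
move=> [V [clV GV VG]] [V' [clV' HV VH]]; exists (fun n => V n `&` V' n); split.
- by move=> n; exact: closedI.
- by move=> n z [/GV Gz /HV Hz]; rewrite interiorI; split.
- by move=> z Vz; split; [apply: VG|apply: VH] => n _; have [] := Vz n I.
Qed.

Lemma regular_Gdelta_preimage (Z W : topologicalType) (f : Z -> W) (G : set W) :
  continuous f -> regular_Gdelta G -> regular_Gdelta (f @^-1` G).
Proof.
move=> fC [V [clV GV VG]]; exists (fun n => f @^-1` V n); split.
- by move=> n; exact: closed_comp.
- by move=> n z Gz; apply: fC; exact: GV.
- by move=> z Vz; apply: VG => n _; exact: Vz.
Qed.

(** The axiom gives countably many closed neighbourhoods of [x] with
    intersection inside [U]; applying it again to the interior of each of them,
    and iterating, yields a tree of closed neighbourhoods [T l] of [x] with root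
    [U], in which the children of each node intersect inside its interior. The
    intersection of all the nodes except the root is the required set. *)
Lemma regular_Gdelta_basis (W : topologicalType) (U : set W) (x : W) :
  T2delta W -> open U -> U x -> exists G, [/\ regular_Gdelta G, G x & G `<=` U].
Proof.
move=> [_ T2] oU Ux.
have /boolp.choice[S SP] : forall O : set W, exists S : nat -> set W,
    open O -> O x ->
    [/\ forall n, closed (S n), forall n, nbhs x (S n) & \bigcap_n S n `<=` O].
  move=> O; have [[oO Ox]|nO] := pselect (open O /\ O x); last first.
    by exists (fun=> set0) => oO Ox; case: nO.
  have [F [/countable_injP[e einj] FP FO]] := T2 _ _ oO Ox.
  (* [F] may be empty or finite: the indices not coming from [F] give the
     whole space. *)
  exists (fun n => \bigcap_(A in [set A | F A /\ e A = n]) A) => _ _; split.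
  - by move=> n; apply: closed_bigI => A [/FP[]].
  - move=> n; have [[A [FA eA]]|nA] := pselect (exists A, F A /\ e A = n).
      have [_] := FP _ FA; apply: filterS => z Az B [FB eB].
      suff -> : B = A by [].
      by apply: einj; rewrite ?inE // eA.
    by apply: filterS filterT => z _ A [FA eA]; case: nA; exists A.
  - by move=> z Sz; apply: FO => A FA; apply: (Sz (e A) I).
pose T := fix T (l : seq nat) : set W :=
  if l is n :: l' then S (interior (T l')) n else U.
have Tx l : nbhs x (T l).
  elim: l => [|n l IH] /=; first exact: open_nbhs_nbhs.
  by have [] := SP (interior (T l)) (@open_interior _ _) IH.
have TS l : [/\ forall n, closed (T (n :: l)), forall n, nbhs x (T (n :: l))
    & \bigcap_n T (n :: l) `<=` interior (T l)].
  by apply: SP; [exact: open_interior|exact: Tx].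
pose V k := if choice.unpickle k is Some (n, l) then T (n :: l) else setT.
have VT n l : V (choice.pickle (n, l)) = T (n :: l).
  by rewrite /V choice.pickleK.
exists (\bigcap_k V k); split.
- exists V; split=> // k.
    rewrite /V; case: choice.unpickle => [[n l]|]; last exact: closedT.
    by case: (TS l).
  move=> z Vz; rewrite {1}/V; case: (choice.unpickle k) => [[n l]|]; last first.
    by rewrite interiorT.
  by case: (TS (n :: l)) => _ _; apply=> m _; rewrite -VT; exact: Vz.
- move=> k _; rewrite /V; case: choice.unpickle => [[n l]|//].
  exact: nbhs_singleton (Tx _).
- move=> z Vz; apply: interior_subset.
  by case: (TS [::]) => _ _; apply=> m _; rewrite -VT; exact: Vz.
Qed.

(** A continuous injection into a [T2delta] space is enough, as regular G-delta
    sets can be pulled back. *)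
Lemma regular_Gdelta_separates (Y : topologicalType) (y z : Y) :
  vecT2delta Y -> y <> z -> exists G, [/\ regular_Gdelta G, G y & ~ G z].
Proof.
move=> [W [f [/bij_inj finj fC T2]]] yz.
have [|U [oU]] := proj1 T2 (f y) (f z).
  by apply/eqP => /finj.
rewrite !inE => Uy nUz.
have [G [rG Gy GU]] := regular_Gdelta_basis T2 oU Uy.
exists (f @^-1` G); split=> //; first exact: regular_Gdelta_preimage.
by move=> /GU.
Qed.

(** * Limit points of the image of a homomorphism *)

Lemma shiftr_continuous (Y : semitopologicalSemilatticeType) (a : Y) :
  continuous (fun z : Y => (z * a)%g).
Proof.
have -> : (fun z : Y => (z * a)%g) = (fun z : Y => (a * z)%g).
  by apply/funext => z; exact: slmulC.
exact: shift_continuous.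
Qed.

Section ClosureOfImage.
Variables (X : topologizedSemilatticeType) (Y : semitopologicalSemilatticeType).
Variable h : X -> Y.
Hypotheses (cX : complete_semilattice X) (T2Y : vecT2delta Y).
Hypotheses (hM : {morph h : x y / (x * y)%g}) (hC : continuous h).
Variable y : Y.
Hypothesis hy : closure (range h) y.

Lemma closed_preimage_h (A : set Y) : closed A -> closed (h @^-1` A).
Proof. by move=> clA; exact: closed_comp. Qed.

(** The point [sup_n inf_k P n k] works, where [P n k] is the product of
    [x n], ..., [x (n + k)]. Since the operation is only separately continuous,
    the condition put on the later factors by [x n] is recorded in a decreasing
    sequence of open neighbourhoods [O n] of [y]: if [z] is in [O n.+1] then
    [h (x n) * z] is in [O n]. *)
Lemma regular_Gdelta_meets_image (G : set Y) :
  regular_Gdelta G -> G y -> exists x, G (h x).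
Proof.
move=> [V [clV GV VG]] Gy.
(* The second condition on [p O] says that [z = y] satisfies the requirement
   that [h (p O) * z] is in [O], which is then open and met near [y]. *)
have /boolp.choice[p pP] : forall O : set Y, exists x : X,
    open O -> O y -> O (h x) /\ O (h x * y)%g.
  move=> O; have [[oO Oy]|nO] := pselect (open O /\ O y); last first.
    have [_ [[x _ _] _]] := hy filterT.
    by exists x => oO Oy; case: nO.
  have [|_ [[x _ <-] [Ox Oxy]]] := hy (B := O `&` [set z | O (z * y)%g]).
    apply: filterI; first exact: open_nbhs_nbhs.
    apply: (@shiftr_continuous Y y y); rewrite slmulxx; exact: open_nbhs_nbhs.
  by exists x.
pose O := fix O n : set Y := if n is m.+1
  then O m `&` interior (V m.+1) `&` [set z | O m (h (p (O m)) * z)%g]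
  else interior (V 0).
pose x n := p (O n).
have OP n : open (O n) /\ O n y.
  elim: n => [|n [oO Oy]] /=; first by split; [exact: open_interior|exact: GV].
  have [_ Oxy] := pP _ oO Oy; split; last by split=> //; split=> //; exact: GV.
  apply: openI; first by apply: openI => //; exact: open_interior.
  by apply: open_comp oO => z _; exact: shift_continuous.
have OV n : O n `<=` V n.
  by case: n => [|n] z; [exact: interior_subset|move=> [[_ /interior_subset]]].
have OS m n : (m <= n)%N -> O n `<=` O m.
  elim: n => [|n IH]; first by rewrite leqn0 => /eqP ->.
  rewrite leq_eqVlt => /orP[/eqP -> //|/IH Omn] z [[/Omn]] //.
pose P := fix P n k : X := if k is j.+1 then (x n * P n.+1 j)%g else x n.
have PO n k : O n (h (P n k)).
  elim: k n => [|k IH] n /=; first by have [oO Oy] := OP n; case: (pP _ oO Oy).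
  by have [_] := IH n.+1; rewrite hM.
have Pdecr n k : P n k.+1 ≼ P n k.
  elim: k n => [|k IH] n; first exact: mul_lel.
  have /natural_leP PE := IH n.+1; apply/natural_leP.
  change ((x n * P n.+1 k.+1) * (x n * P n.+1 k) = x n * P n.+1 k.+1)%g.
  rewrite -mulgA (mulgA (P n.+1 k.+1)) (slmulC _ (x n)) -mulgA PE.
  by rewrite mulgA slmulxx.
have Ple n j k : (j <= k)%N -> P n k ≼ P n j.
  elim: k => [|k IH]; first by rewrite leqn0 => /eqP ->; exact: lexx.
  rewrite leq_eqVlt => /orP[/eqP -> //|/IH jk].
  exact: le_trans (Pdecr n k) jk.
have /boolp.choice[q qP] : forall n, exists q : X,
    infimums (range (P n) : set (natural X)) q /\
    forall j, (j <= n)%N -> V j (h q).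
  move=> n; have [||[q qinf clq] _] := @cX (range (P n)).
  - by exists (P n 0), 0.
  - apply/chainP => _ _ [j _ <-] [k _ <-].
    by have [jk|/ltnW kj] := leqP j k; [right|left]; exact: Ple.
  exists q; split=> // j jn.
  apply: (closed_preimage_h (clV j)); apply: closureS clq => _ [k _ <-].
  exact/OV/(OS _ _ jn)/PO.
have qincr n : q n ≼ q n.+1.
  have [[lbn _] _] := qP n; have [[_ glb] _] := qP n.+1.
  apply: glb => _ [k _ <-]; apply: (@le_trans _ (natural X) (P n k.+1)).
    by apply: lbn; exists k.+1.
  exact: mul_ler.
have qle m n : (m <= n)%N -> q m ≼ q n.
  elim: n => [|n IH]; first by rewrite leqn0 => /eqP ->; exact: lexx.
  rewrite leq_eqVlt => /orP[/eqP -> //|/IH mn].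
  exact: le_trans mn (qincr n).
have qdir : directed (range q).
  move=> _ _ [m _ <-] [n _ <-]; exists (q (maxn m n)).
  split; first by exists (maxn m n).
    by apply: qle; exact: leq_maxl.
  by apply: qle; exact: leq_maxr.
have q0 : range q !=set0 by exists (q 0), 0.
have [s sq _] := directed_supremum cX q0 qdir.
exists s; apply: VG => n _.
apply: (@directed_supremum_in _ cX _ (h @^-1` V n) _ q0 qdir sq).
  exact: closed_preimage_h.
move=> _ [m _ <-]; exists (q (maxn m n)); split.
- by exists (maxn m n).
- by have [_] := qP (maxn m n); apply; exact: leq_maxr.
- by apply: qle; exact: leq_maxl.
Qed.

(** Nearness to [y] is measured by regular G-delta sets instead of
    neighbourhoods of [y]; by [regular_Gdelta_meets_image] it is not vacuous. *)
Definition below_near (x : X) : Prop :=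
  exists N : set Y, [/\ regular_Gdelta N, N y & forall z, N (h z) -> x ≼ z].

(** A minimal element of the set of [x] with [h x * y] in [G] is below all [z]
    with [h z] near [y], so [h m <= y] in the limit, and [h m = h m * y] is
    in [G]. *)
Lemma below_near_in (G : set Y) : regular_Gdelta G -> G y ->
  exists2 m, below_near m & G (h m).
Proof.
move=> rG Gy.
have rGy (a : Y) : regular_Gdelta [set z : Y | G (a * z)%g].
  exact: (regular_Gdelta_preimage (@shift_continuous _ a) rG).
have clM : closed [set x | G (h x * y)%g].
  apply: (@closed_preimage_h [set z | G (z * y)%g]).
  apply: (@closed_comp _ _ (fun z : Y => (z * y)%g)).
    by move=> z _; exact: shiftr_continuous.
  exact: regular_Gdelta_closed.
have [|m Gmy mmin] := closed_minimal cX clM.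
  have [|x Gx] := @regular_Gdelta_meets_image _ (rGy y).
    by rewrite /= slmulxx.
  by exists x; rewrite /= slmulC.
pose N : set Y := [set z | G (h m * y * z)%g].
have rN : regular_Gdelta N := rGy _.
have Ny : N y by rewrite /N /= -mulgA slmulxx.
have Nm z : N (h z) -> m ≼ z.
  move=> Nz; apply/natural_leP/mmin; last exact: mul_lel.
  by rewrite /= hM -mulgA (slmulC _ y) mulgA.
exists m; first by exists N.
suff <- : (h m * y)%g = h m by [].
(* Otherwise some [x] with [h x] near [y] has [h (m * x)] near [h m * y], hence
   different from [h m], although [m * x = m]. *)
apply: contrapT => neq.
have [R [rR Rmy nRm]] := regular_Gdelta_separates T2Y neq.
have [||x [Rx /Nm/natural_leP mx]] :=
    @regular_Gdelta_meets_image ((fun z : Y => (h m * z)%g) @^-1` R `&` N).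
- apply: regular_GdeltaI rN; apply: regular_Gdelta_preimage rR.
  exact: shift_continuous.
- by [].
- by apply: nRm; rewrite -mx hM.
Qed.

Lemma closure_in_image : range h y.
Proof.
have cof (G : set Y) d : regular_Gdelta G -> G y -> below_near d ->
    exists c, [/\ below_near c, (h @^-1` G) c & d ≼ c].
  move=> rG Gy [N [rN Ny Nd]].
  have [||c Dc [Gc /Nd dc]] := @below_near_in (G `&` N) => //.
    exact: regular_GdeltaI.
  by exists c.
have Ddir : directed below_near.
  move=> a b Da [N [rN Ny Nb]].
  by have [c [Dc /Nb bc ac]] := cof _ _ rN Ny Da; exists c.
have D0 : below_near !=set0.
  have rT : regular_Gdelta (setT : set Y).
    exists (fun=> setT); split=> // n.
    by rewrite interiorT.
  by have [m Dm _] := below_near_in rT I; exists m.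
have [s sD _] := directed_supremum cX D0 Ddir.
exists s => //; apply: contrapT => sy.
have [G [rG Gy]] := regular_Gdelta_separates T2Y (fun e => sy (esym e)).
apply; apply: (directed_supremum_in cX D0 Ddir sD (A := h @^-1` G)).
  by apply: closed_preimage_h; exact: regular_Gdelta_closed.
by move=> d; exact: cof.
Qed.

End ClosureOfImage.

Theorem theorem4 (X : topologizedSemilatticeType)
    (Y : semitopologicalSemilatticeType) (h : X -> Y)
    (cX : complete_semilattice X) (T2Y : vecT2delta Y)
    (hM : {morph h : x y / (x * y)%g}) (hC : continuous h) :
  closed (range h).
Proof. by move=> y; exact: closure_in_image. Qed.
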